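(* Let $X$ be a random variable with Gamma distribution $\Gamma(\alpha,\theta)$, $\alpha,\theta>0$ (density $\frac{x^{\alpha-1}e^{-x/\theta}}{\theta^\alpha\Gamma(\alpha)}$, $x>0$), and let $s\geq1$ be an integer. If $\alpha\geq 1$, then $X$ is $s$-IFR. If $\alpha<1$, then $X$ is $s$-DFR.
   Context: For a nonnegative random variable $X$ with density $f_X$: set $\overline{T}_{X,0}=f_X$, $\widetilde{\mu}_{X,0}=1$, and for $s\geq1$, $x\geq0$, $\overline{T}_{X,s}(x)=\frac{1}{\widetilde{\mu}_{X,s-1}}\int_x^\infty \overline{T}_{X,s-1}(t)\,dt$ with $\widetilde{\mu}_{X,s}=\int_0^\infty \overline{T}_{X,s}(t)\,dt$. The $s$-iterated failure rate is $r_{X,s}(x)=\frac{\overline{T}_{X,s-1}(x)}{\int_x^\infty \overline{T}_{X,s-1}(t)\,dt}$ for $x\geq 0$ (so $r_{X,1}=f_X/(1-F_X)$). $X$ is called $s$-IFR (resp. $s$-DFR) if $r_{X,s}$ is increasing (resp. decreasing) on $[0,\infty)$.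
   Formalization: For α<1 and s=1 the density is infinite at 0, so r_{X,1}(0) is undefined; in that case ''decreasing'' is asserted on (0,∞) instead of [0,∞). For s≥2, and for α≥1, it is on all of [0,∞). *)

(* Defs.v *)
From HB Require Import structures.
From mathcomp Require Import all_boot all_order all_algebra.
From mathcomp Require Import all_classical all_reals all_analysis.
Set Implicit Arguments. Unset Strict Implicit. Unset Printing Implicit Defensive.
Import Order.TTheory GRing.Theory Num.Theory.
Import numFieldNormedType.Exports.
Local Open Scope classical_set_scope.
Local Open Scope ring_scope.

Section Defs.
Variable R : realType.

Definition tail_int (g : R -> R) (x : R) : R :=
  Rintegral (@lebesgue_measure R) `[x, +oo[ g.

Definition Gamma_fn (a : R) : R :=
  Rintegral (@lebesgue_measure R) `]0, +oo[ (fun t => t `^ (a - 1) * expR (- t)).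

(* density of Gamma(alpha, theta): x^(alpha-1) e^(-x/theta) / (theta^alpha Gamma(alpha))
   for x > 0; 0 for x < 0.  At x = 0 we use the formula with powR (0 `^ 0 = 1,
   0 `^ b = 0 for b <> 0), i.e. the right limit when alpha >= 1. *)
Definition gamma_pdf (alpha theta : R) (x : R) : R :=
  if 0 <= x then
    x `^ (alpha - 1) * expR (- (x / theta)) / (theta `^ alpha * Gamma_fn alpha)
  else 0.

Fixpoint Tmu (f : R -> R) (s : nat) : (R -> R) * R :=
  match s with
  | 0%N => (f, 1)
  | s'.+1 =>
      let T := (Tmu f s').1 in
      let m := (Tmu f s').2 in
      let T' := fun x => tail_int T x / m in
      (T', tail_int T' 0)
  end.

Definition Tbar (f : R -> R) (s : nat) : R -> R := (Tmu f s).1.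
Definition mutilde (f : R -> R) (s : nat) : R := (Tmu f s).2.

Definition iter_fr (f : R -> R) (s : nat) (x : R) : R :=
  Tbar f s.-1 x / tail_int (Tbar f s.-1) x.

Definition s_IFR (f : R -> R) (s : nat) : Prop :=
  forall x y : R, 0 <= x -> x <= y -> iter_fr f s x <= iter_fr f s y.
Definition s_DFR (f : R -> R) (s : nat) : Prop :=
  forall x y : R, 0 <= x -> x <= y -> iter_fr f s y <= iter_fr f s x.

(* Variant of s_DFR on (0,+oo) when s = 1 (the Gamma density with alpha < 1 is
   infinite at 0, so r_{X,1}(0) is not a real number); on [0,+oo) for s >= 2. *)
Definition s_DFR_pos (f : R -> R) (s : nat) : Prop :=
  forall x y : R, 0 <= x -> (1 < s)%N \/ 0 < x -> x <= y ->
    iter_fr f s y <= iter_fr f s x.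
End Defs.

(* Main.v *)
(* Write [G] for the tail integral of a density [g].  The failure rate [g / G]
   is increasing iff [g t * G u <= g u * G t] for all [t <= u].  Fixing [y] and
   integrating such a cross inequality first over [u >= y], then over
   [x < t <= y], yields the same inequality for the pair formed by [G] and its
   own tail integral, so monotonicity of the failure rate propagates through
   the iteration; exchanging the roles of [g] and [G] covers the decreasing
   case.  For the Gamma density itself, substituting [u = t + (y - x)] in
   [G y] reduces the cross inequality to [x * (t + y - x) <= y * t] for
   [0 <= x <= t], raised to the power [alpha - 1].  Exponential decay, which is
   stable under taking tails, keeps all the integrals finite. *)
Require Import Defs.
From HB Require Import structures.
From mathcomp Require Import all_boot all_order all_algebra.
From mathcomp Require Import all_classical all_reals all_analysis.
From mathcomp Require Import measurable_realfun ring lra.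
Import Order.TTheory GRing.Theory Num.Theory.
Import numFieldNormedType.Exports.
Local Open Scope classical_set_scope.
Local Open Scope ring_scope.

(** * Tail integrals and the integration of cross inequalities *)

Section tail_integral.
Context {R : realType}.
Implicit Types (g : R -> R) (x y c : R).
Notation mu := (@lebesgue_measure R).

Lemma integrable_itvcyS x y g : x <= y ->
  mu.-integrable `[x, +oo[ (EFin \o g) -> mu.-integrable `[y, +oo[ (EFin \o g).
Proof.
move=> xy; apply: integrableS => //.
by apply: subset_itvr; rewrite bnd_simp.
Qed.

Lemma integrable_itvocS x y z g : z <= x ->
  mu.-integrable `[z, +oo[ (EFin \o g) -> mu.-integrable `]x, y] (EFin \o g).
Proof.
move=> zx; apply: integrableS => // t /=; rewrite !in_itv/= => /andP[xt _].
by rewrite andbT (le_trans zx)// ltW.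
Qed.

Lemma tail_int_split x y g : x <= y ->
  mu.-integrable `[x, +oo[ (EFin \o g) ->
  tail_int g x = Rintegral mu `]x, y] g + tail_int g y.
Proof.
move=> xy gi; rewrite /tail_int.
have oy z : x <= z -> mu.-integrable `]z, +oo[ (EFin \o g).
  move=> xz; apply: integrableS gi => //.
  by apply: subset_itvr; rewrite bnd_simp.
rewrite -(@Rintegral_itv_obnd_cbnd _ x); last exact: oy.
rewrite -(@Rintegral_itv_obnd_cbnd _ y); last exact: oy.
rewrite -(@Rintegral_itvB _ _ (BRight x) _ y)//; last exact: oy.
by rewrite addrC subrK.
Qed.

Lemma tail_int_ge0 x g : (forall t, x <= t -> 0 <= g t) -> 0 <= tail_int g x.
Proof.
move=> g0; apply: Rintegral_ge0 => t /=; rewrite in_itv/= andbT; exact: g0.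
Qed.

Lemma tail_int_le x y g : x <= y -> (forall t, x <= t -> 0 <= g t) ->
  mu.-integrable `[x, +oo[ (EFin \o g) -> tail_int g y <= tail_int g x.
Proof.
move=> xy g0 gi; rewrite (tail_int_split _ _ _ xy gi) lerDr.
apply: Rintegral_ge0 => t /=; rewrite in_itv/= => /andP[xt _].
exact/g0/ltW.
Qed.

Lemma le_tail_int x f g :
  mu.-integrable `[x, +oo[ (EFin \o f) ->
  mu.-integrable `[x, +oo[ (EFin \o g) ->
  (forall t, x <= t -> f t <= g t) -> tail_int f x <= tail_int g x.
Proof.
move=> fi gi fg; apply: le_Rintegral => // t /=.
rewrite in_itv/= andbT; exact: fg.
Qed.

Lemma integrableZl_EFin (D : set R) k g : measurable D ->
  mu.-integrable D (EFin \o g) -> mu.-integrable D (EFin \o (fun t => k * g t)).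
Proof.
by move=> mD gi; rewrite (_ : _ \o _ = fun t => (k%:E * (EFin \o g) t)%E)//;
  exact: integrableZl.
Qed.

Lemma tail_intZl x k g : mu.-integrable `[x, +oo[ (EFin \o g) ->
  tail_int (fun t => k * g t) x = k * tail_int g x.
Proof. by move=> gi; rewrite /tail_int RintegralZl. Qed.

(** If the integral vanished, [g] would be zero almost everywhere on the ray, and []x, +oo[], which
    has infinite measure, would lie in a null set. *)
Lemma tail_int_gt0 x g : (forall t, x <= t -> 0 <= g t) ->
  (forall t, x < t -> 0 < g t) ->
  mu.-integrable `[x, +oo[ (EFin \o g) -> 0 < tail_int g x.
Proof.
move=> g0 gp gi; rewrite lt0r tail_int_ge0// andbT.
apply/eqP => t0.
have [mg _] := integrableP _ _ _ gi.
have : (\int[mu]_(t in `[x, +oo[) `|(EFin \o g) t|)%E = 0%E.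
  transitivity (\int[mu]_(t in `[x, +oo[) (g t)%:E)%E.
    apply: eq_integral => t; rewrite inE/= in_itv/= andbT => xt.
    by rewrite ger0_norm// g0.
  rewrite -[LHS]fineK; last exact: integrable_fin_num.
  by rewrite -[X in X%:E]/(tail_int g x) t0.
move/ae_eq_integral_abs => /(_ _ mg)[]//= N [mN N0 sub].
have : (mu `]x, +oo[ <= mu N)%E.
  apply: le_measure; rewrite ?inE// => t /=; rewrite in_itv/= andbT => xt.
  apply: sub => /= /(_ _).
  rewrite in_itv/= andbT (ltW xt) => /(_ isT) [] gt0.
  by have := gp _ xt; rewrite gt0 ltxx.
by rewrite N0 lebesgue_measure_itv/= ltry.
Qed.

(* Integrating [g1 t * g2 u <= g1 u * g2 t] over [u >= y] and then over
   [x < t <= y] bounds [(tail g1 x - tail g1 y) * tail g2 y], whose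
   diagonal part [tail g1 y * tail g2 y] cancels. *)
Lemma tail_int_cross x y g1 g2 : x <= y ->
  mu.-integrable `[x, +oo[ (EFin \o g1) ->
  mu.-integrable `[x, +oo[ (EFin \o g2) ->
  (forall t u, x < t -> t <= y -> y <= u -> g1 t * g2 u <= g1 u * g2 t) ->
  tail_int g1 x * tail_int g2 y <= tail_int g1 y * tail_int g2 x.
Proof.
move=> xy g1i g2i g12.
have g1iy := integrable_itvcyS _ _ _ xy g1i.
have g2iy := integrable_itvcyS _ _ _ xy g2i.
have ic g : mu.-integrable `[x, +oo[ (EFin \o g) ->
  mu.-integrable `]x, y] (EFin \o g) by exact: integrable_itvocS.
rewrite (tail_int_split _ _ _ xy g1i) (tail_int_split _ _ _ xy g2i).
rewrite mulrDl mulrDr lerD2r mulrC -!RintegralZl//; [|exact: ic..].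
apply: le_Rintegral => //; try by apply: integrableZl_EFin => //; exact: ic.
move=> t /=; rewrite in_itv/= => /andP[xt ty].
rewrite mulrC -tail_intZl// mulrC -tail_intZl//.
apply: le_tail_int; try exact: integrableZl_EFin.
by move=> u yu; rewrite [leRHS]mulrC g12.
Qed.

End tail_integral.

(** * Exponential decay and its stability under tails *)

Section exponential_decay.
Context {R : realType}.
Implicit Types (g : R -> R) (x y c : R).
Notation mu := (@lebesgue_measure R).

Lemma continuous_expRNM c : continuous (fun t : R => expR (- (c * t))).
Proof.
move=> t; apply: continuous_comp; last exact: continuous_expR.
by apply: (@continuousN _ R^o); apply: mulrl_continuous.
Qed.

Lemma integral_expRNM_itvcy x c : 0 < c ->
  (\int[mu]_(t in `[x, +oo[) (expR (- (c * t)))%:E)%E =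
  (c^-1 * expR (- (c * x)))%:E.
Proof.
move=> c0.
have dF (t : R) : is_derive t 1 (fun t => - (c^-1 * expR (- (c * t))))
    (expR (- (c * t))).
  apply: is_derive_eq; rewrite /GRing.scale/=; field; exact: lt0r_neq0.
rewrite (@ge0_continuous_FTC2y _ _ (fun t => - (c^-1 * expR (- (c * t)))) _ 0).
- by rewrite -EFinB opprK add0r.
- by move=> t _; exact: expR_ge0.
- by apply: continuous_subspaceT => t; exact: continuous_expRNM.
- rewrite -oppr0 -(mulr0 c^-1); apply: cvgN; apply: cvgMr.
  apply: (@cvg_comp _ _ _ (fun t => c * t) (fun z => expR (- z)) _ (pinfty_nbhs R)).
    exact: gt0_cvgMry.
  exact: cvgr_expR.
- by move=> t _; exact: ex_derive.
- apply: cvg_at_right_filter; apply: cvgN; apply: cvgMr.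
  exact: continuous_expRNM.
- by move=> t _; rewrite derive1E derive_val.
Qed.

Lemma integrable_expRNM x c : 0 < c ->
  mu.-integrable `[x, +oo[ (EFin \o (fun t => expR (- (c * t)))).
Proof.
move=> c0; apply/integrableP; split.
  apply/measurable_EFinP; apply: measurable_funTS.
  by apply: continuous_measurable_fun; exact: continuous_expRNM.
under eq_integral do rewrite /= ger0_norm ?expR_ge0//.
by rewrite integral_expRNM_itvcy// ltry.
Qed.

Lemma tail_int_expRNM x c : 0 < c ->
  tail_int (fun t => expR (- (c * t))) x = c^-1 * expR (- (c * x)).
Proof. by move=> c0; rewrite /tail_int /Rintegral integral_expRNM_itvcy. Qed.

(* The bound starts at [1] because the Gamma density is unbounded near [0]
   when [alpha < 1]. *)
Definition exp_decay c g :=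
  [/\ mu.-integrable `[0, +oo[ (EFin \o g), forall t, 0 <= t -> 0 <= g t,
      forall t, 0 < t -> 0 < g t &
      exists K, forall t, 1 <= t -> g t <= K * expR (- (c * t))].

Lemma exp_decayZ c k g : 0 < k -> exp_decay c g ->
  exp_decay c (fun t => k * g t).
Proof.
move=> k0 [gi g0 gp [K gK]]; split.
- exact: integrableZl_EFin.
- by move=> t /g0; apply: mulr_ge0; exact: ltW.
- by move=> t /gp; exact: mulr_gt0.
- by exists (k * K) => t /gK gtK; rewrite -mulrA ler_pM2l.
Qed.

(** The tail of [K * expR (- (c * t))] is the same exponential divided by [c], so the rate [c]
    survives. Integrability on the whole half-line follows by domination by a multiple of this
    exponential, since the tail is bounded by its value at 0. *)
Lemma exp_decay_tail_int c g : 0 < c -> exp_decay c g ->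
  exp_decay c (tail_int g).
Proof.
move=> c0 [gi g0 gp [K gK]].
have gix x : 0 <= x -> mu.-integrable `[x, +oo[ (EFin \o g).
  by move=> x0; apply: integrable_itvcyS gi.
have G0 x : 0 <= x -> 0 < tail_int g x.
  move=> x0; apply: tail_int_gt0 (gix _ x0) => t xt.
    exact/g0/(le_trans x0).
  exact/gp/(le_lt_trans x0).
have Gle x y : 0 <= x -> x <= y -> tail_int g y <= tail_int g x.
  move=> x0 xy; apply: tail_int_le (gix _ x0) => // t xt.
  exact/g0/(le_trans x0).
have GK t : 1 <= t -> tail_int g t <= K / c * expR (- (c * t)).
  move=> t1; rewrite -mulrA -tail_int_expRNM// -tail_intZl; last first.
    exact: integrable_expRNM.
  apply: le_tail_int; first by apply: gix; lra.
    exact/integrableZl_EFin/integrable_expRNM.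
  by move=> u tu; apply: gK; exact: le_trans tu.
split; [|by move=> t /G0/ltW|by move=> t /ltW/G0|by exists (K / c)].
(* The first summand dominates the tail for [1 <= t]; the second does so on [[0, 1[], where
   [expR c * expR (- (c * t))] is at least 1. The absolute value is there because the sign of [K] is
   not recorded. *)
pose M := `|K| / c + tail_int g 0 * expR c.
have Mi : mu.-integrable `[0, +oo[ (EFin \o (fun t => M * expR (- (c * t)))).
  exact/integrableZl_EFin/integrable_expRNM.
apply: le_integrable Mi => //.
(* Monotonicity of the tail is known only on [[0, +oo[]; clamping the argument at 0 makes the
   function nonincreasing on all of [R] without changing it on the domain. *)
- have mG : measurable_fun `[(0 : R), +oo[ (fun t : R => tail_int g (Num.max 0 t)).
    apply: nonincreasing_measurable => // s t st.
    apply: Gle; first by rewrite le_max lexx.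
    by rewrite ge_max !le_max lexx st orbT.
  apply/measurable_EFinP; apply: eq_measurable_fun mG => t.
  by rewrite inE/= in_itv/= andbT => /max_idPr ->.
- move=> t /=; rewrite in_itv/= andbT => t0.
  have M0 : 0 <= M.
    rewrite /M addr_ge0// ?divr_ge0 ?normr_ge0 ?(ltW c0)//.
    by rewrite mulr_ge0 ?expR_ge0// ltW// G0.
  rewrite lee_fin !ger0_norm ?mulr_ge0 ?expR_ge0 ?(ltW (G0 _ t0))//.
  have [t1|t1] := leP 1 t.
    apply: (le_trans (GK _ t1)); rewrite ler_wpM2r ?expR_ge0// /M.
    rewrite ler_wpDr ?mulr_ge0 ?expR_ge0 ?(ltW (G0 _ _))//.
    by rewrite ler_wpM2r ?ler_norm// invr_ge0 ltW.
  apply: (le_trans (Gle _ _ (lexx 0) t0)).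
  rewrite /M mulrDl ler_wpDl//.
    by rewrite mulr_ge0 ?expR_ge0// divr_ge0// ltW.
  rewrite -mulrA ler_peMr ?(ltW (G0 _ _))//.
  rewrite -expRD -expR0 ler_expR; nra.
Qed.

End exponential_decay.

(** * The Gamma kernel and its integrability *)

Section gamma_kernel.
Context {R : realType}.
Implicit Types (g : R -> R) (a c d t x y theta : R).
Notation mu := (@lebesgue_measure R).

Lemma integral_itvcy_shift d x g : (forall t, x + d <= t -> 0 <= g t) ->
  {within `[x + d, +oo[, continuous g} ->
  (\int[mu]_(t in `[(x + d)%R, +oo[) (g t)%:E =
   \int[mu]_(t in `[x, +oo[) (g (t + d)%R)%:E)%E.
Proof.
move=> g0 gc.
have dS : derive1 (fun t : R => t + d) = cst 1.
  by apply/funext => t; rewrite derive1E derive_val addr0.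
rewrite (@increasing_ge0_integration_by_substitutiony _ (fun t => t + d) g x)//.
- by apply: eq_integral => t _; rewrite dS /= mulr1.
- by move=> s t _ _ st; rewrite ltrD2r.
- by rewrite dS => t _; exact: cvg_cst.
- by rewrite dS; exact: is_cvg_cst.
- by rewrite dS; exact: is_cvg_cst.
- split; first by move=> t _; exact: ex_derive.
  by apply: cvg_at_right_filter; apply: cvgD; [exact: cvg_id|exact: cvg_cst].
- apply/cvgryPge => A; near=> t; rewrite -lerBlDr; near: t.
  by apply: nbhs_pinfty_ge; rewrite num_real.
- by move=> t; rewrite in_itv/= andbT => /ltW; exact: g0.
Unshelve. all: by end_near. Qed.

(** The Gamma density without its normalising constant, which cancels in every failure rate. *)
Definition gamma_ker a theta t := t `^ (a - 1) * expR (- (t / theta)).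

Lemma gamma_ker_ge0 a theta t : 0 <= gamma_ker a theta t.
Proof. by rewrite mulr_ge0 ?powR_ge0 ?expR_ge0. Qed.

Lemma gamma_ker_gt0 a theta t : 0 < t -> 0 < gamma_ker a theta t.
Proof. by move=> t0; rewrite mulr_gt0 ?powR_gt0 ?expR_gt0. Qed.

Lemma continuous_powR_gt0 a t : 0 < t -> {for t, continuous (fun s : R => s `^ a)}.
Proof.
move=> t0; apply: differentiable_continuous; apply/derivable1_diffP.
by apply: derivable_powR; rewrite in_itv/= t0.
Qed.

Lemma continuous_gamma_ker a theta t : 0 < t ->
  {for t, continuous (gamma_ker a theta)}.
Proof.
move=> t0.
have -> : gamma_ker a theta = fun s => s `^ (a - 1) * expR (- (theta^-1 * s)).
  by apply/funext => s; rewrite /gamma_ker (mulrC s).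
by apply: cvgM; [exact: continuous_powR_gt0|exact: continuous_expRNM].
Qed.

Lemma measurable_gamma_ker a theta : measurable_fun setT (gamma_ker a theta).
Proof.
apply: measurable_funM; first exact: measurable_powR.
apply: measurableT_comp => //; apply: measurableT_comp => //.
exact: measurable_funM.
Qed.

(** Half of the exponential rate [1 / theta] is given up to absorb the power of [t]. *)
Lemma gamma_ker_bound a theta : 0 < theta ->
  exists K, forall t, 1 <= t ->
    gamma_ker a theta t <= K * expR (- ((2 * theta)^-1 * t)).
Proof.
move=> th0; pose c := (2 * theta)^-1; pose b := `|a - 1| + 1.
have c0 : 0 < c by rewrite invr_gt0 mulr_gt0.
have b0 : 0 < b by rewrite ltr_wpDl.
(* The bound [ln z < z] at [z = c / b * t], multiplied by [b], gives
   [b * ln t <= c * t - b * ln (c / b)]. Since [ln t >= 0] and [a - 1 <= b], this also bounds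
   [(a - 1) * ln t]; the added 1 in [b] makes it positive. *)
exists (expR (- (b * ln (c / b)))) => t t1.
have t0 : 0 < t by exact: lt_le_trans t1.
rewrite /gamma_ker /powR gt_eqF// -!expRD ler_expR -/c.
have -> : t / theta = c * t *+ 2.
  by rewrite /c mulr2n; field; exact: lt0r_neq0.
have /ltW : ln (c / b * t) < c / b * t.
  by apply: ln_sublinear; rewrite mulr_gt0// divr_gt0.
rewrite lnM ?posrE ?divr_gt0// => H.
have {}H : b * ln (c / b) + b * ln t <= c * t.
  rewrite -mulrDr; apply: le_trans (ler_wpM2l (ltW b0) H) _.
  by rewrite le_eqVlt; apply/orP; left; apply/eqP; field; exact: lt0r_neq0.
have : (a - 1) * ln t <= b * ln t.
  by rewrite ler_wpM2r ?ln_ge0// /b ler_wpDr// ler_norm.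
by rewrite mulr2n; lra.
Qed.

Lemma integral_powR_itv01_lty a : 0 < a ->
  (\int[mu]_(t in `]0%R, 1%R]) (t `^ (a - 1))%:E < +oo)%E.
Proof.
move=> a0; apply: (@le_lt_trans _ _ (a^-1)%:E); last exact: ltry.
rewrite itv_open_bnd_bigcup.
have mp (D : set R) : measurable_fun D (EFin \o (fun t : R => t `^ (a - 1))).
  by apply/measurable_EFinP; apply: measurable_funTS; exact: measurable_powR.
pose F n := `[(0 + n.+1%:R^-1 : R), 1]%classic.
have cvF : (\int[mu]_(t in F n) (t `^ (a - 1))%:E)%E @[n --> \oo] -->
    (\int[mu]_(t in \bigcup_n F n) (t `^ (a - 1))%:E)%E.
  apply: ge0_nondecreasing_set_cvg_integral => //.
  - move=> m n mn; apply/subsetPset => t; rewrite /F /= !in_itv/= !add0r.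
    move=> /andP[mt ->]; rewrite andbT (le_trans _ mt)//.
    by rewrite lef_pV2 ?posrE// ler_nat.
  - by move=> n; exact: measurable_itv.
  - by move=> n; exact: mp.
  - by move=> n t _; rewrite lee_fin powR_ge0.
rewrite -(cvg_lim _ cvF)//; apply: lime_le; first by apply/cvg_ex; eexists; exact: cvF.
(* The index 0 gives the single point 1, which is treated apart because the fundamental theorem is
   applied with distinct endpoints. *)
apply: nearW => n; rewrite /F add0r; case: n => [|n].
  by rewrite invr1 set_itv1 integral_set1 lee_fin invr_ge0 ltW.
have n0 : (0 : R) < n.+2%:R^-1 by rewrite invr_gt0.
have dF t : 0 < t -> is_derive t 1 (fun t => a^-1 * t `^ a) (t `^ (a - 1)).
  move=> t0; have dp := is_derive1_powR a t0; apply: is_derive_eq.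
  by rewrite /GRing.scale/= mulrA mulVf ?mul1r// lt0r_neq0.
have cF t : 0 < t -> {for t, continuous (fun t => a^-1 * t `^ a)}.
  by move=> t0; apply: cvgMr; exact: continuous_powR_gt0.
have n1 : (n.+2%:R^-1 : R) < 1 by rewrite invf_lt1// ltr1n.
rewrite (@continuous_FTC2 _ _ (fun t => a^-1 * t `^ a))//.
- rewrite powR1 mulr1 -EFinB lee_fin gerBl mulr_ge0 ?powR_ge0//.
  by rewrite invr_ge0 ltW.
- apply: continuous_in_subspaceT => t; rewrite inE/= in_itv/= => /andP[nt _].
  exact/continuous_powR_gt0/(lt_le_trans n0).
- split.
  + move=> t; rewrite in_itv/= => /andP[nt _].
    by have := dF _ (lt_trans n0 nt) => ?; exact: ex_derive.
  + exact/cvg_at_right_filter/cF.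
  + exact/cvg_at_left_filter/cF.
- move=> t; rewrite in_itv/= => /andP[nt _].
  by have := dF _ (lt_trans n0 nt) => ?; rewrite derive1E derive_val.
Qed.

(** The half-line is cut at 1: on []0, 1]] the exponential is at most 1 and the power dominates,
    beyond 1 the exponential bound does. *)
Lemma integrable_gamma_ker a theta : 0 < a -> 0 < theta ->
  mu.-integrable `[0, +oo[ (EFin \o gamma_ker a theta).
Proof.
move=> a0 th0.
have mk (D : set R) : measurable_fun D (EFin \o gamma_ker a theta).
  by apply/measurable_EFinP; apply: measurable_funTS; exact: measurable_gamma_ker.
apply/integrableP; split; first exact: mk.
under eq_integral do rewrite /= ger0_norm ?gamma_ker_ge0//.
rewrite -integral_itv_obnd_cbnd; last exact: mk.
rewrite (@itv_bndbnd_setU _ _ _ (BRight 1)) ?bnd_simp//.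
have k0 t : (0 <= (gamma_ker a theta t)%:E)%E by rewrite lee_fin gamma_ker_ge0.
rewrite ge0_integral_setU//=; last 2 first.
- exact: mk.
- apply/disj_setPS => t [/=]; rewrite !in_itv/= => /andP[_ t1].
  by rewrite andbT ltNge t1.
apply: lte_add_pinfty.
  apply: le_lt_trans (integral_powR_itv01_lty a a0).
  apply: ge0_le_integral => //.
  - exact: mk.
  - have mp : measurable_fun `](0 : R), 1] (fun t : R => t `^ (a - 1)).
      by apply: measurable_funTS; exact: measurable_powR.
    exact/measurable_EFinP.
  - move=> t /=; rewrite in_itv/= => /andP[t0 _].
    rewrite lee_fin ler_piMr ?powR_ge0// -expR0 ler_expR oppr_le0.
    by rewrite divr_ge0// ltW.
have [K gK] := gamma_ker_bound a theta th0.
have c0 : 0 < (2 * theta)^-1 by rewrite invr_gt0 mulr_gt0.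
have Ki : mu.-integrable `]1, +oo[
    (EFin \o (fun t => K * expR (- ((2 * theta)^-1 * t)))).
  apply: integrableS (integrableZl_EFin _ K _ _ (integrable_expRNM 1 _ c0)) => //.
  by apply: subset_itvr; rewrite bnd_simp.
have : mu.-integrable `]1, +oo[ (EFin \o gamma_ker a theta).
  apply: le_integrable Ki => //; first exact: mk.
  move=> t /=; rewrite in_itv/= andbT => t1; rewrite lee_fin.
  rewrite ger0_norm ?gamma_ker_ge0// (le_trans _ (ler_norm _))//.
  exact/gK/ltW.
move=> /integrableP[_]; congr (_ < _)%E.
by apply: eq_integral => t _; rewrite /= ger0_norm ?gamma_ker_ge0.
Qed.

End gamma_kernel.

(** * Cross inequalities for the Gamma kernel *)

Section gamma_failure_rate.
Context {R : realType}.
Implicit Types (f g : R -> R) (a c d t x y theta : R) (s : nat).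
Notation mu := (@lebesgue_measure R).

(** Brings the tail at [x + d] onto the ray of the tail at [x], so that integrands can be compared
    pointwise. As [x + d] is positive, the shifted ray avoids a possible singularity at 0. *)
Lemma gamma_ker_tail_shift a theta d x : 0 < a -> 0 < theta -> 0 <= x -> 0 < d ->
  mu.-integrable `[x, +oo[ (EFin \o (fun t => gamma_ker a theta (t + d))) /\
  tail_int (gamma_ker a theta) (x + d) =
  tail_int (fun t => gamma_ker a theta (t + d)) x.
Proof.
move=> a0 th0 x0 d0.
have xd0 : 0 < x + d by rewrite ltr_wpDl.
have kc : {within `[x + d, +oo[, continuous (gamma_ker a theta)}.
  apply: continuous_in_subspaceT => t; rewrite inE/= in_itv/= andbT => xdt.
  exact/continuous_gamma_ker/(lt_le_trans xd0).
have shiftE := integral_itvcy_shift d x _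
  (fun t _ => gamma_ker_ge0 a theta t) kc.
split; last by rewrite /tail_int /Rintegral shiftE.
apply/integrableP; split.
  apply/measurable_EFinP; apply: measurable_funTS.
  apply: measurableT_comp; first exact: measurable_gamma_ker.
  exact: measurable_funD.
under eq_integral do rewrite /= ger0_norm ?gamma_ker_ge0//.
rewrite -shiftE.
have /integrableP[_] := integrable_itvcyS _ _ _ (ltW xd0)
  (integrable_gamma_ker a theta a0 th0).
congr (_ < _)%E; apply: eq_integral => t _ /=.
by rewrite ger0_norm ?gamma_ker_ge0.
Qed.

(** The product depends only on [x * y] and [x + y], so two pairs with equal sum are compared
    through their products alone. *)
Lemma gamma_kerM a theta x y : 0 <= x -> 0 <= y ->
  gamma_ker a theta x * gamma_ker a theta y =
  (x * y) `^ (a - 1) * expR (- ((x + y) / theta)).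
Proof.
move=> x0 y0; rewrite /gamma_ker powRM// mulrDl opprD expRD; ring.
Qed.

Lemma gamma_ker_cross_ge1 a theta x y : 1 <= a -> 0 < theta ->
  0 <= x -> x <= y ->
  gamma_ker a theta x * tail_int (gamma_ker a theta) y <=
  gamma_ker a theta y * tail_int (gamma_ker a theta) x.
Proof.
move=> a1 th0 x0; rewrite le_eqVlt => /predU1P[<-//|xy].
have a0 : 0 < a by exact: lt_le_trans a1.
have d0 : 0 < y - x by rewrite subr_gt0.
have [si] := gamma_ker_tail_shift a theta (y - x) x a0 th0 x0 d0.
have ki := integrable_itvcyS _ _ _ x0 (integrable_gamma_ker a theta a0 th0).
rewrite (addrC x) subrK => ->; rewrite -!tail_intZl//.
apply: le_tail_int; try exact: integrableZl_EFin.
move=> t xt; have t0 := le_trans x0 xt; rewrite !gamma_kerM; try lra.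
(* The exponential factors now coincide, and the products differ by [y * t - x * (t + (y - x)) = (y
   - x) * (t - x)], which is nonnegative. *)
rewrite (_ : x + (t + (y - x)) = y + t); last by ring.
rewrite ler_wpM2r ?expR_ge0//.
by apply: ge0_ler_powR; rewrite ?nnegrE ?subr_ge0//; nra.
Qed.

Lemma gamma_ker_cross_lt1 a theta x y : 0 < a < 1 -> 0 < theta ->
  0 < x -> x <= y ->
  gamma_ker a theta y * tail_int (gamma_ker a theta) x <=
  gamma_ker a theta x * tail_int (gamma_ker a theta) y.
Proof.
move=> /andP[a0 a1] th0 x0; rewrite le_eqVlt => /predU1P[<-//|xy].
have d0 : 0 < y - x by rewrite subr_gt0.
have [si] := gamma_ker_tail_shift a theta (y - x) x a0 th0 (ltW x0) d0.
have ki := integrable_itvcyS _ _ _ (ltW x0) (integrable_gamma_ker a theta a0 th0).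
rewrite (addrC x) subrK => ->; rewrite -!tail_intZl//.
apply: le_tail_int; try exact: integrableZl_EFin.
move=> t xt; have t0 := lt_le_trans x0 xt; rewrite !gamma_kerM; try lra.
rewrite (_ : x + (t + (y - x)) = y + t); last by ring.
rewrite ler_wpM2r ?expR_ge0//.
(* The exponent [a - 1] is negative, so the comparison of products is reversed by taking inverses.
   Positivity of [x] matters: at 0 the convention for [powR] makes the kernel 0 and the inequality
   fails. *)
rewrite -(opprB 1 a) !powRN lef_pV2 ?posrE ?powR_gt0; try nra.
by apply: ge0_ler_powR; rewrite ?nnegrE; nra.
Qed.

Lemma exp_decay_gamma_ker a theta : 0 < a -> 0 < theta ->
  exp_decay (2 * theta)^-1 (gamma_ker a theta).
Proof.
move=> a0 th0; split; [exact: integrable_gamma_ker| | |exact: gamma_ker_bound].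
- by move=> t _; exact: gamma_ker_ge0.
- exact: gamma_ker_gt0.
Qed.

(** Up to the null endpoint 0, [Gamma_fn a] is the tail at 0 of the kernel of scale 1. *)
Lemma Gamma_fn_gt0 a : 0 < a -> 0 < Gamma_fn a.
Proof.
move=> a0; have ki := integrable_gamma_ker a 1 a0 ltr01.
have -> : Gamma_fn a = tail_int (gamma_ker a 1) 0.
  rewrite /Gamma_fn /tail_int -Rintegral_itv_obnd_cbnd.
    by apply: eq_Rintegral => t _; rewrite /gamma_ker divr1.
  by apply: integrableS ki => //; apply: subset_itvr; rewrite bnd_simp.
by apply: tail_int_gt0 ki => t t0; [exact: gamma_ker_ge0|exact: gamma_ker_gt0].
Qed.

(** * Propagation through the iterated tails *)

Lemma eq_tail_int f g x : (forall t, x <= t -> f t = g t) ->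
  tail_int f x = tail_int g x.
Proof.
by move=> fg; apply: eq_Rintegral => t; rewrite inE/= in_itv/= andbT => /fg.
Qed.

Lemma eq_exp_decay c f g : (forall t, 0 <= t -> f t = g t) ->
  exp_decay c f -> exp_decay c g.
Proof.
move=> fg [fi f0 fp [K fK]]; split.
- apply: eq_integrable fi => // t; rewrite inE/= in_itv/= andbT => t0.
  by rewrite /= fg.
- by move=> t t0; rewrite -fg// f0.
- by move=> t t0; rewrite -fg ?fp// ltW.
- exists K => t t1; rewrite -fg ?fK//; lra.
Qed.

(** The two claims are proved together: positivity of [mutilde f s] makes the next normalisation a
    positive scaling, and decay of the next tail makes the next [mutilde] positive. *)
Lemma exp_decay_Tbar c f s : 0 < c -> exp_decay c f ->
  exp_decay c (Tbar f s) /\ 0 < mutilde f s.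
Proof.
move=> c0 cf; elim: s => [|s [IH m0]]; first by [].
have cT : exp_decay c (Tbar f s.+1).
  apply: (@eq_exp_decay c (fun t => (mutilde f s)^-1 * tail_int (Tbar f s) t)).
    by move=> t _; rewrite mulrC.
  by apply: exp_decayZ; [rewrite invr_gt0|exact: exp_decay_tail_int].
by split=> //; have [Ti T0 Tp _] := cT; exact: tail_int_gt0 Ti.
Qed.

Lemma tail_int_Tbar c f s x : 0 < c -> exp_decay c f -> 0 <= x ->
  tail_int (Tbar f s.+1) x = (mutilde f s)^-1 * tail_int (tail_int (Tbar f s)) x.
Proof.
move=> c0 cf x0; have [cT _] := exp_decay_Tbar _ _ s c0 cf.
have [Gi _ _ _] := exp_decay_tail_int _ _ c0 cT.
rewrite -tail_intZl; last exact: integrable_itvcyS x0 Gi.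
by apply: eq_tail_int => t _; rewrite mulrC.
Qed.

Lemma TbarS_cross_incr c f s x y : 0 < c -> exp_decay c f ->
  (forall t u, 0 < t -> t <= u -> Tbar f s t * tail_int (Tbar f s) u <=
     Tbar f s u * tail_int (Tbar f s) t) -> 0 <= x -> x <= y ->
  Tbar f s.+1 x * tail_int (Tbar f s.+1) y <=
  Tbar f s.+1 y * tail_int (Tbar f s.+1) x.
Proof.
move=> c0 cf Tc x0 xy; have y0 := le_trans x0 xy.
have [cT m0] := exp_decay_Tbar _ _ s c0 cf.
have [Gi _ _ _] := exp_decay_tail_int _ _ c0 cT; have [Ti _ _ _] := cT.
rewrite !(tail_int_Tbar c)// -[Tbar f s.+1 x]/(_ / _) -[Tbar f s.+1 y]/(_ / _).
(* Both sides carry the same squared normalising factor, which is cancelled. *)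
rewrite ![(mutilde f s)^-1 * _]mulrC !(mulrACA _ _^-1).
rewrite ler_wpM2r ?mulr_ge0 ?invr_ge0 ?(ltW m0)//.
apply: tail_int_cross => //; try exact: integrable_itvcyS x0 _.
by move=> t u xt ty yu; apply: Tc; lra.
Qed.

(** The integration over []x, y]] samples only [t > x], so an inequality known for positive
    arguments gives the next one at [x = 0] as well. This is how the point 0 is gained after one
    step. *)
Lemma TbarS_cross_decr c f s x y : 0 < c -> exp_decay c f ->
  (forall t u, 0 < t -> t <= u -> Tbar f s u * tail_int (Tbar f s) t <=
     Tbar f s t * tail_int (Tbar f s) u) -> 0 <= x -> x <= y ->
  Tbar f s.+1 y * tail_int (Tbar f s.+1) x <=
  Tbar f s.+1 x * tail_int (Tbar f s.+1) y.
Proof.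
move=> c0 cf Tc x0 xy; have y0 := le_trans x0 xy.
have [cT m0] := exp_decay_Tbar _ _ s c0 cf.
have [Gi _ _ _] := exp_decay_tail_int _ _ c0 cT; have [Ti _ _ _] := cT.
rewrite !(tail_int_Tbar c)// -[Tbar f s.+1 x]/(_ / _) -[Tbar f s.+1 y]/(_ / _).
rewrite ![(mutilde f s)^-1 * _]mulrC !(mulrACA _ _^-1).
rewrite ler_wpM2r ?mulr_ge0 ?invr_ge0 ?(ltW m0)//.
(* After commuting the factors, [tail_int_cross] applies with the tail as [g1] and [Tbar f s] itself
   as [g2]. *)
rewrite mulrC [leRHS]mulrC.
apply: tail_int_cross => //; try exact: integrable_itvcyS x0 _.
by move=> t u xt ty yu; rewrite mulrC [leRHS]mulrC; apply: Tc; lra.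
Qed.

Lemma Tbar_cross_incr c f s x y : 0 < c -> exp_decay c f ->
  (forall t u, 0 <= t -> t <= u -> f t * tail_int f u <= f u * tail_int f t) ->
  0 <= x -> x <= y ->
  Tbar f s x * tail_int (Tbar f s) y <= Tbar f s y * tail_int (Tbar f s) x.
Proof.
move=> c0 cf fc; elim: s x y => [|s IH] x y x0 xy; first exact: fc.
by apply: (TbarS_cross_incr c) => // t u /ltW; exact: IH.
Qed.

(** Here [s] is the index of [Tbar], one less than the order of the failure rate, so [0 < s] is the
    condition [1 < s] of [s_DFR_pos]. *)
Lemma Tbar_cross_decr c f s x y : 0 < c -> exp_decay c f ->
  (forall t u, 0 < t -> t <= u -> f u * tail_int f t <= f t * tail_int f u) ->
  0 <= x -> (0 < s)%N \/ 0 < x -> x <= y ->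
  Tbar f s y * tail_int (Tbar f s) x <= Tbar f s x * tail_int (Tbar f s) y.
Proof.
move=> c0 cf fc; elim: s x y => [|s IH] x y x0 sx xy.
  by apply: fc => //; case: sx.
apply: (TbarS_cross_decr c) => // t u t0 tu.
by apply: IH => //; [exact: ltW|right].
Qed.

Lemma tail_int_Tbar_gt0 c f s x : 0 < c -> exp_decay c f -> 0 <= x ->
  0 < tail_int (Tbar f s) x.
Proof.
move=> c0 cf x0; have [[Ti T0 Tp _] _] := exp_decay_Tbar _ _ s c0 cf.
apply: tail_int_gt0; last exact: integrable_itvcyS x0 Ti.
  by move=> t xt; exact/T0/(le_trans x0).
by move=> t xt; exact/Tp/(le_lt_trans x0).
Qed.

(** * From the kernel to the normalised density *)

Lemma gamma_pdfE a theta t : 0 <= t -> gamma_pdf a theta t =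
  (theta `^ a * Gamma_fn a)^-1 * gamma_ker a theta t.
Proof. by move=> t0; rewrite /gamma_pdf t0 mulrC. Qed.

Lemma tail_int_gamma_pdf a theta x : 0 < a -> 0 < theta -> 0 <= x ->
  tail_int (gamma_pdf a theta) x =
  (theta `^ a * Gamma_fn a)^-1 * tail_int (gamma_ker a theta) x.
Proof.
move=> a0 th0 x0; rewrite -tail_intZl.
  by apply: eq_tail_int => t xt; rewrite gamma_pdfE// (le_trans x0).
exact: integrable_itvcyS x0 (integrable_gamma_ker _ _ a0 th0).
Qed.

Lemma exp_decay_gamma_pdf a theta : 0 < a -> 0 < theta ->
  exp_decay (2 * theta)^-1 (gamma_pdf a theta).
Proof.
move=> a0 th0; apply: eq_exp_decay.
  by move=> t t0; rewrite gamma_pdfE.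
apply: exp_decayZ; last exact: exp_decay_gamma_ker.
by rewrite invr_gt0 mulr_gt0 ?powR_gt0 ?Gamma_fn_gt0.
Qed.

End gamma_failure_rate.

Theorem theorem2 (R : realType) (alpha theta : R) (s : nat) :
  0 < alpha -> 0 < theta -> (1 <= s)%N ->
  (1 <= alpha -> s_IFR (gamma_pdf alpha theta) s) /\
  (alpha < 1 -> s_DFR_pos (gamma_pdf alpha theta) s).
Proof.
move=> a0 th0; case: s => // s _.
have c0 : 0 < (2 * theta)^-1 by rewrite invr_gt0 mulr_gt0.
have cf := exp_decay_gamma_pdf _ _ a0 th0.
have k0 : 0 <= (theta `^ alpha * Gamma_fn alpha)^-1.
  by rewrite invr_ge0 mulr_ge0 ?powR_ge0// ltW// Gamma_fn_gt0.
split=> [a1 x y x0 xy|a1 x y x0 sx xy]; have y0 := le_trans x0 xy;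
  have Tx := tail_int_Tbar_gt0 _ _ s _ c0 cf x0;
  have Ty := tail_int_Tbar_gt0 _ _ s _ c0 cf y0;
  (* Both denominators are positive, so comparing failure rates amounts to a cross inequality. *)
  rewrite /iter_fr/= ler_pdivrMr// mulrAC ler_pdivlMr//.
- apply: (Tbar_cross_incr _ _ _ _ _ c0 cf) => // t u t0 tu.
  have u0 := le_trans t0 tu.
  rewrite !gamma_pdfE// !tail_int_gamma_pdf// !(mulrACA _ _ _^-1).
  rewrite ler_wpM2l ?mulr_ge0//; exact: gamma_ker_cross_ge1.
- apply: (Tbar_cross_decr _ _ _ _ _ c0 cf) => // t u t0 tu.
  have t0' := ltW t0; have u0 := le_trans t0' tu.
  rewrite !gamma_pdfE// !tail_int_gamma_pdf// !(mulrACA _ _ _^-1).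
  by rewrite ler_wpM2l ?mulr_ge0//; apply: gamma_ker_cross_lt1; rewrite ?a0.
Qed.
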